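(* Let $M\in\mathbb{C}^{p\times p}$ be invertible, let $\mathcal{A}\in\mathbb{C}^{m\times m\times p}$, $\mathcal{B}\in\mathbb{C}^{n\times n\times p}$, $\mathcal{P}_1\in\mathbb{C}^{m\times m\times p}$, $\mathcal{P}_2\in\mathbb{C}^{n\times n\times p}$ be nonsingular and $\mathcal{C}\in\mathbb{C}^{m\times n\times p}$, with $\mathcal{A}^{-1}\ge0$, $\mathcal{B}^{-1}\ge0$, $(\mathcal{P}_1*_M\mathcal{A})^{-1}\ge0$ and $(\mathcal{B}*_M\mathcal{P}_2)^{-1}\ge0$. Let $\mathcal{A}=\mathcal{F}_1-\mathcal{G}_1$, $\mathcal{P}_1*_M\mathcal{A}=\mathcal{F}_{p_1}-\mathcal{G}_{p_1}$, $\mathcal{B}=\mathcal{F}_2-\mathcal{G}_2$ and $\mathcal{B}*_M\mathcal{P}_2=\mathcal{F}_{p_2}-\mathcal{G}_{p_2}$ be weak regular splittings of $\mathcal{A}$, $\mathcal{P}_1*_M\mathcal{A}$, $\mathcal{B}$ and $\mathcal{B}*_M\mathcal{P}_2$ respectively. If $$\rho(\mathcal{F}_{p_1}^{-1}*_M\mathcal{G}_{p_1})<\rho(\mathcal{F}_1^{-1}*_M\mathcal{G}_1)\quad\text{and}\quad\rho(\mathcal{F}_{p_2}^{-1}*_M\mathcal{G}_{p_2})<\rho(\mathcal{F}_2^{-1}*_M\mathcal{G}_2),$$ then for all $0<\alpha<1$ and $0<\beta<1$ the preconditioned method $$\mathcal{Y}_{k+1}=(\mathcal{I}_{mmp}-\alpha\mathcal{F}_{p_1}^{-1}*_M\mathcal{P}_1*_M\mathcal{A})*_M\mathcal{Y}_k+\alpha\mathcal{F}_{p_1}^{-1}*_M\mathcal{P}_1*_M\mathcal{C}*_M\mathcal{P}_2,$$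 $$\mathcal{X}_{k+1}=\mathcal{X}_k*_M(\mathcal{I}_{nnp}-\beta\mathcal{B}*_M\mathcal{P}_2*_M\mathcal{F}_{p_2}^{-1})+\beta\mathcal{Y}_{k+1}*_M\mathcal{F}_{p_2}^{-1}$$ converges faster than the method $$\mathcal{Y}_{k+1}=(\mathcal{I}_{mmp}-\alpha\mathcal{F}_1^{-1}*_M\mathcal{A})*_M\mathcal{Y}_k+\alpha\mathcal{F}_1^{-1}*_M\mathcal{C},$$ $$\mathcal{X}_{k+1}=\mathcal{X}_k*_M(\mathcal{I}_{nnp}-\beta\mathcal{B}*_M\mathcal{F}_2^{-1})+\beta\mathcal{Y}_{k+1}*_M\mathcal{F}_2^{-1},$$ in the sense that the spectral radii of its iteration tensors are strictly smaller: $$\rho(\mathcal{I}_{mmp}-\alpha\mathcal{F}_{p_1}^{-1}*_M\mathcal{P}_1*_M\mathcal{A})<\rho(\mathcal{I}_{mmp}-\alpha\mathcal{F}_1^{-1}*_M\mathcal{A}),$$ $$\rho(\mathcal{I}_{nnp}-\beta\mathcal{B}*_M\mathcal{P}_2*_M\mathcal{F}_{p_2}^{-1})<\rho(\mathcal{I}_{nnp}-\beta\mathcal{B}*_M\mathcal{F}_2^{-1}).$$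
   Context: For $\mathcal{A}\in\mathbb{C}^{m\times n\times p}$, $\mathcal{A}(:,:,i)\in\mathbb{C}^{m\times n}$ ($1\le i\le p$) denotes the $i$-th frontal slice. For the fixed invertible matrix $M\in\mathbb{C}^{p\times p}$, $\tilde{\mathcal{A}}:=\mathcal{A}\times_3 M$ is defined by $\tilde{\mathcal{A}}(i_1,i_2,k)=\sum_{i_3=1}^p \mathcal{A}(i_1,i_2,i_3)M(k,i_3)$. The $M$-product of $\mathcal{A}\in\mathbb{C}^{m\times n\times p}$ and $\mathcal{B}\in\mathbb{C}^{n\times k\times p}$ is the tensor $\mathcal{A}*_M\mathcal{B}\in\mathbb{C}^{m\times k\times p}$ given by $\mathcal{A}*_M\mathcal{B}=\mathcal{W}\times_3 M^{-1}$, where $\mathcal{W}(:,:,i)=\tilde{\mathcal{A}}(:,:,i)\,\tilde{\mathcal{B}}(:,:,i)$ for $i=1,\dots,p$. The identity tensor $\mathcal{I}_{mmp}\in\mathbb{C}^{m\times m\times p}$ is the tensor such that each $\tilde{\mathcal{I}}_{mmp}(:,:,i)$ is the $m\times m$ identity matrix. $\mathcal{A}\in\mathbb{C}^{m\times m\times p}$ is nonsingular (invertible) if there is $\mathcal{Z}=:\mathcal{A}^{-1}$ with $\mathcal{A}*_M\mathcal{Z}=\mathcal{Z}*_M\mathcal{A}=\mathcal{I}_{mmp}$. The spectral radius of $\mathcal{A}\in\mathbb{C}^{m\times m\times p}$ is $\rho(\mathcal{A})=\max_{1\le i\le p}\rho(\tilde{\mathcal{A}}(:,:,i))$. A tensor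 $\mathcal{A}$ is nonnegative, $\mathcal{A}\ge0$, if every entry of $\tilde{\mathcal{A}}$ is a real number $\ge 0$. A splitting $\mathcal{A}=\mathcal{F}-\mathcal{G}$ of a nonsingular tensor $\mathcal{A}$, with $\mathcal{F}$ nonsingular, is weak regular if $\mathcal{F}^{-1}\ge0$ and $\mathcal{F}^{-1}*_M\mathcal{G}\ge0$. *)

(* Defs.v *)
From HB Require Import structures.
From mathcomp Require Import all_boot all_order all_algebra.
From mathcomp Require Import boolp classical_sets reals.
From mathcomp Require Import complex.

Set Implicit Arguments.
Unset Strict Implicit.
Unset Printing Implicit Defensive.

Import Order.TTheory GRing.Theory Num.Theory.
Local Open Scope ring_scope.

(* An m x n x p tensor is the family of its p frontal slices: A k i j stands
   for A(i,j,k). Addition, subtraction and scaling are the pointwise ones. *)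
Notation tensor K m n p := {ffun 'I_p -> 'M[K]_(m, n)}.

Section MProduct.
Variable K : fieldType.

Definition mode3 m n p (A : tensor K m n p) (M : 'M[K]_p) : tensor K m n p :=
  [ffun k => \matrix_(i, j) \sum_(l < p) A l i j * M k l].

Definition mprod m n q p (M : 'M[K]_p)
    (A : tensor K m n p) (B : tensor K n q p) : tensor K m q p :=
  mode3 [ffun k => mode3 A M k *m mode3 B M k] (invmx M).

Definition tid m p (M : 'M[K]_p) : tensor K m m p :=
  mode3 [ffun _ => 1%:M] (invmx M).

Definition is_tinv m p (M : 'M[K]_p) (A Z : tensor K m m p) : Prop :=
  mprod M A Z = tid m M /\ mprod M Z A = tid m M.

Definition nonsingular m p (M : 'M[K]_p) (A : tensor K m m p) : Prop :=
  exists Z, is_tinv M A Z.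

(* The inverse is unique for invertible M (is_tinv_unique); 0 is a default
   value, returned only when A is singular. *)
Definition tinv m p (M : 'M[K]_p) (A : tensor K m m p) : tensor K m m p :=
  xget 0 [set Z | is_tinv M A Z].

Lemma mode3M m n p (A : tensor K m n p) (M N : 'M[K]_p) :
  mode3 (mode3 A M) N = mode3 A (N *m M).
Proof.
apply/ffunP => k; rewrite !ffunE; apply/matrixP => i j; rewrite !mxE.
under eq_bigr => l _ do rewrite ffunE mxE mulr_suml.
rewrite exchange_big /=; apply: eq_bigr => l _; rewrite mxE mulr_sumr.
by apply: eq_bigr => s _; rewrite -mulrA [M _ _ * _]mulrC.
Qed.

Lemma mode3_1 m n p (A : tensor K m n p) : mode3 A 1%:M = A.
Proof.
apply/ffunP => k; rewrite !ffunE; apply/matrixP => i j; rewrite !mxE.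
rewrite (bigD1 k) //= mxE eqxx mulr1 big1 ?addr0 // => l /negbTE lk.
by rewrite mxE eq_sym lk mulr0.
Qed.

Lemma mode3K m n p (M : 'M[K]_p) : M \in unitmx ->
  cancel (fun A : tensor K m n p => mode3 A M) (fun A => mode3 A (invmx M)).
Proof. by move=> uM A; rewrite mode3M mulVmx // mode3_1. Qed.

Lemma mode3VK m n p (M : 'M[K]_p) : M \in unitmx ->
  cancel (fun A : tensor K m n p => mode3 A (invmx M)) (fun A => mode3 A M).
Proof. by move=> uM A; rewrite mode3M mulmxV // mode3_1. Qed.

Lemma mode3_mprod m n q p (M : 'M[K]_p)
    (A : tensor K m n p) (B : tensor K n q p) k : M \in unitmx ->
  mode3 (mprod M A B) M k = mode3 A M k *m mode3 B M k.
Proof. by move=> uM; rewrite /mprod mode3VK // ffunE. Qed.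

Lemma mode3_tid m p (M : 'M[K]_p) k : M \in unitmx ->
  mode3 (tid m M) M k = 1%:M.
Proof. by move=> uM; rewrite /tid mode3VK // ffunE. Qed.

Lemma is_tinv_unique m p (M : 'M[K]_p) (A Z Z' : tensor K m m p) :
  M \in unitmx -> is_tinv M A Z -> is_tinv M A Z' -> Z = Z'.
Proof.
move=> uM [_ ZA] [AZ' _]; apply: (can_inj (mode3K uM)).
apply/ffunP => k; rewrite -[LHS]mulmx1 -(mode3_tid m k uM) -AZ' mode3_mprod //.
by rewrite mulmxA -mode3_mprod // ZA mode3_tid // mul1mx.
Qed.

Lemma tinvP m p (M : 'M[K]_p) (A : tensor K m m p) :
  nonsingular M A -> is_tinv M A (tinv M A).
Proof. exact: (@xgetPex _ 0 [set Z | is_tinv M A Z]). Qed.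

End MProduct.

Notation "A *_[ M ] B" := (mprod M A B)
  (at level 40, left associativity, format "A  *_[ M ]  B") : ring_scope.

Section Spectral.
Variable R : realType.
Local Notation C := R[i].

(* The set of eigenvalues is finite, so the supremum is a maximum
   (and it is 0 for the empty matrix). *)
Definition spectral_radius m (A : 'M[C]_m) : R :=
  sup [set complex.Re `|a| | a in [set a | eigenvalue A a]].

Definition tspectral_radius m p (M : 'M[C]_p) (A : tensor C m m p) : R :=
  \big[Num.max/0]_(k < p) spectral_radius (mode3 A M k).

(* On R[i], 0 <= z means that z is real and nonnegative. *)
Definition tnonneg m n p (M : 'M[C]_p) (A : tensor C m n p) : Prop :=
  forall k i j, 0 <= mode3 A M k i j.

Definition weak_regular_splitting m p (M : 'M[C]_p)
    (A F G : tensor C m m p) : Prop :=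
  [/\ A = F - G, nonsingular M A, nonsingular M F,
      tnonneg M (tinv M F) & tnonneg M (tinv M F *_[M] G)].

(* The coefficients of the iteration two_step below. *)
Record two_step_method m n p := TwoStepMethod {
  Yiter : tensor C m m p;
  Yconst : tensor C m n p;
  Xiter : tensor C n n p;
  Xgain : tensor C n n p }.

Definition two_step m n p (M : 'M[C]_p) (S : two_step_method m n p)
    (YX : tensor C m n p * tensor C m n p) : tensor C m n p * tensor C m n p :=
  let Y' := Yiter S *_[M] YX.1 + Yconst S in
  (Y', YX.2 *_[M] Xiter S + Y' *_[M] Xgain S).

Definition converges_faster m n p (M : 'M[C]_p)
    (S T : two_step_method m n p) : Prop :=
  tspectral_radius M (Yiter S) < tspectral_radius M (Yiter T) /\
  tspectral_radius M (Xiter S) < tspectral_radius M (Xiter T).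

End Spectral.

(* Main.v *)
Require Import Defs.
From HB Require Import structures.
From mathcomp Require Import all_boot all_order all_algebra.
From mathcomp Require Import boolp classical_sets reals.
From mathcomp Require Import complex polyrcf lra.

Set Implicit Arguments.
Unset Strict Implicit.
Unset Printing Implicit Defensive.

Import Order.TTheory GRing.Theory Num.Theory.
Local Open Scope ring_scope.

(* With T = F^-1 *_M G >= 0, the relaxed iteration tensor I - a F^-1 *_M A is
   (1 - a) I + a T. Since the spectral radius of a nonnegative matrix is one of
   its eigenvalues (weak Perron-Frobenius), the spectral radius of
   (1 - a) I + a T is (1 - a) + a rho(T), which is strictly increasing in
   rho(T). The tensor I - b B *_M F^-1 is slicewise similar to
   I - b F^-1 *_M B.
   For the Perron-Frobenius step, suppose x >= 0 is nonzero with x T >= r x,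
   and T has no real eigenvalue s >= r > 0. Then r - t T is invertible for
   t in [0, 1], and y(t) = 1 (r - t T)^-1, which is positive at t = 0, stays
   positive: at a first zero of an entry y(t) >= 0 still holds, but then
   r y(t) = 1 + t y(t) T > 0. So y = y(1) > 0 satisfies y T < r y, which
   contradicts x T >= r x at an index maximizing x_i / y_i. *)

(** * Positivity of real polynomials along an interval *)

Lemma poly_root_of_le0 (F : rcfType) (p : {poly F}) (a b : F) :
  a <= b -> 0 < p.[a] -> p.[b] <= 0 -> exists2 x, a < x <= b & root p x.
Proof.
move=> ab pa pb.
have [|x /andP[ax xb]] := @poly_ivt _ (- p) a b ab.
  by rewrite !hornerN oppr_le0 oppr_ge0 ltW.
rewrite rootN => px; exists x => //; rewrite xb andbT lt_neqAle ax andbT.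
by apply: contraTneq px => <-; rewrite rootE gt_eqF.
Qed.

(** At the first root in []0, 1]] of the product of the [q i], no factor can be negative, since it
    would have vanished earlier; the second hypothesis then makes every factor positive there, a
    contradiction. *)
Lemma poly_pos_continuation (F : rcfType) (I : finType) (q : I -> {poly F}) :
  (forall i, 0 < (q i).[0]) ->
  (forall t, 0 <= t <= 1 -> (forall i, 0 <= (q i).[t]) ->
     forall i, 0 < (q i).[t]) ->
  forall i, 0 < (q i).[1].
Proof.
move=> q0 qpos i; rewrite ltNge; apply/negP => qi1.
pose Q := \prod_j q j.
have rootQ x : reflect (exists j, root (q j) x) (root Q x).
  rewrite rootE horner_prod; apply: (iffP (prodf_eq0 _ _)) => -[j].
    by move=> _ qj; exists j.
  by move=> qj; exists j.
have [x /andP[x0 x1] qx] := poly_root_of_le0 ler01 (q0 i) qi1.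
have {qx} Qx : root Q x by apply/rootQ; exists i.
(* Any bound above 1 will do: the search for the first root is on an open interval that must contain
   [x <= 1]. *)
have x2 : x < 2 by lra.
have [y [y0 yx Qy noroot]] : exists y,
    [/\ 0 < y, y <= x, root Q y & {in `]0, y[, forall z, ~~ root Q z}].
  case: (next_rootP Q 0 2) => [Q0|y _ Qy yI noroot|c _ _ noroot].
  - have : 0 < \prod_j (q j).[0] by apply: prodr_gt0 => j _; apply: q0.
    by rewrite -horner_prod -/Q Q0 horner0 ltxx.
  - exists y; move: yI; rewrite in_itv /= => /andP[y0 _]; split=> //.
      rewrite leNgt; apply/negP => xy.
      by have := noroot x; rewrite in_itv /= x0 xy Qx => /(_ isT).
    by apply/rootP.
  - by have := noroot x; rewrite in_itv /= x0 x2 Qx => /(_ isT).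
have /qpos qy_gt0 : 0 <= y <= 1 by lra.
have [j qjy] := rootQ y Qy.
suff /qy_gt0/(_ j) : forall k, 0 <= (q k).[y] by rewrite (rootP qjy) ltxx.
move=> k; rewrite leNgt; apply/negP => qk.
have [z /andP[z0 zy] qz] := poly_root_of_le0 (ltW y0) (q0 k) (ltW qk).
have /noroot/negP[] : z \in `]0, y[; last by apply/rootQ; exists k.
rewrite in_itv /= z0 lt_neqAle zy andbT.
by apply: contraTneq qz => ->; rewrite rootE lt_eqF.
Qed.

(** * Perron-Frobenius step over a real closed field *)

Lemma positive_row_dominated (F : rcfType) m (T : 'M[F]_m) (r : F) :
  (forall i j, 0 <= T i j) -> 0 < r ->
  (forall s, r <= s -> ~~ eigenvalue T s) ->
  exists2 y : 'rV[F]_m, forall j, 0 < y 0 j & forall j, (y *m T) 0 j < r * y 0 j.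
Proof.
move=> T0 r0 noev.
pose N t : 'M[F]_m := r%:M - t *: T.
(* Evaluating this polynomial matrix at [t] gives [N t], so the determinant and adjugate of [N t]
   are polynomial in [t] and root arguments apply to them. *)
pose NX : 'M[{poly F}]_m := (r%:P)%:M - 'X *: map_mx polyC T.
have NXE t : map_mx (horner_eval t) NX = N t.
  apply/matrixP => i j; rewrite !mxE /horner_eval hornerD hornerN hornerM.
  by rewrite hornerMn hornerC hornerX hornerC.
have detE t : (\det NX).[t] = \det (N t) by rewrite -NXE det_map_mx.
pose u : 'rV[F]_m := const_mx 1.
(* (q j).[t] / \det (N t) is the j-th entry of u *m invmx (N t). *)
pose q j : {poly F} := (map_mx polyC u *m \adj NX) 0 j.
have qE t j : (q j).[t] = (u *m \adj (N t)) 0 j.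
  have uE : map_mx (horner_eval t) (map_mx polyC u) = u.
    by apply/matrixP => a b; rewrite !mxE /horner_eval hornerC.
  by rewrite -NXE -map_mx_adj -[X in X *m _]uE -map_mxM [RHS]mxE.
have qN t : (\row_j (q j).[t]) *m N t = (\det (N t)) *: u.
  suff -> : \row_j (q j).[t] = u *m \adj (N t).
    by rewrite -mulmxA mul_adj_mx mul_mx_scalar.
  by apply/rowP => j; rewrite mxE qE.
(* This is [r y(t) = 1 + t y(t) T] multiplied by the determinant of [N t]. *)
have qTE t j : r * (q j).[t] =
    \det (N t) + t * ((\row_j (q j).[t]) *m T) 0 j.
  have /rowP/(_ j) := qN t.
  rewrite mulmxBr mul_mx_scalar -scalemxAr !mxE mulr1 => <-.
  by rewrite subrK.
have N0 : N 0 = r%:M by rewrite /N scale0r subr0.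
have det_neq0 t : 0 <= t <= 1 -> \det (N t) != 0.
  move=> /andP[t0 t1]; apply/negP => /det0P[v v0 vN].
  have [t_eq0|tn0] := eqVneq t 0.
    move: vN; rewrite t_eq0 N0 mul_mx_scalar => /eqP.
    by rewrite scaler_eq0 gt_eqF //= (negbTE v0).
  have tgt0 : 0 < t by rewrite lt_def tn0.
  (* A row killed by [r - t T] is an eigenvector of [T] for [r / t], and [t <= 1]. *)
  have /noev/negP[] : r <= r / t by rewrite ler_pdivlMr // ler_piMr // ltW.
  apply/eigenvalueP; exists v => //; move/eqP: vN.
  rewrite mulmxBr mul_mx_scalar -scalemxAr subr_eq0 => /eqP vN.
  by rewrite mulrC -scalerA vN scalerA mulVf // scale1r.
have det_gt0 t : 0 <= t <= 1 -> 0 < \det (N t).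
  move=> t01; have /andP[t0 t1] := t01; rewrite ltNge -detE; apply/negP => dt.
  have d0 : 0 < (\det NX).[0] by rewrite detE N0 det_scalar exprn_gt0.
  have [z /andP[z0 zt] /rootP] := poly_root_of_le0 t0 d0 dt.
  by rewrite detE; apply/eqP/det_neq0; lra.
have q_gt0 : forall j, 0 < (q j).[1].
  apply: poly_pos_continuation => [j|t t01 qt j].
    by rewrite -(pmulr_rgt0 _ r0) qTE mul0r addr0 det_gt0 // lexx ler01.
  rewrite -(pmulr_rgt0 _ r0) qTE ltr_pwDl ?det_gt0 // mulr_ge0 //.
    by case/andP: t01.
  by rewrite mxE sumr_ge0 // => k _; rewrite mxE mulr_ge0.
exists (\row_j (q j).[1]) => j; first by rewrite mxE.
by rewrite [X in r * X]mxE qTE mul1r ltrDr det_gt0 // lexx ler01.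
Qed.

Lemma subinvariant_eigenvalue (F : rcfType) m (T : 'M[F]_m) (r : F)
    (x : 'rV[F]_m) :
  (forall i j, 0 <= T i j) -> 0 < r -> (forall j, 0 <= x 0 j) -> x != 0 ->
  (forall j, r * x 0 j <= (x *m T) 0 j) ->
  exists2 s, r <= s & eigenvalue T s.
Proof.
move=> T0 r0 x0 xn0 xT.
case: (pselect (exists2 s, r <= s & eigenvalue T s)) => // noev.
have [|y y0 yT] := @positive_row_dominated F m T r T0 r0.
  by move=> s rs; apply/negP => Ts; apply: noev; exists s.
have [k xk] := rV0Pn _ xn0.
case: (@arg_maxP _ _ _ k xpredT (fun j => x 0 j / y 0 j) isT) => i _ imax.
(* The least [c] with [x <= c y], attained at [i]. There [r x_i <= (x T)_i <= c (y T)_i < c r y_i =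
   r x_i]. *)
pose c := x 0 i / y 0 i.
have xE j : x 0 j <= c * y 0 j by rewrite -ler_pdivrMr //; apply: imax.
have c0 : 0 < c.
  by apply: lt_le_trans (imax k isT); rewrite divr_gt0 // lt_def xk x0.
have : r * x 0 i < r * x 0 i.
  apply: (le_lt_trans (xT i)).
  have -> : r * x 0 i = c * (r * y 0 i) by rewrite mulrCA /c divfK ?gt_eqF.
  apply: le_lt_trans (_ : c * (y *m T) 0 i < _); last by rewrite ltr_pM2l.
  rewrite !mxE mulr_sumr ler_sum // => j _.
  by rewrite mulrA ler_wpM2r.
by rewrite ltxx.
Qed.

(** * Similarity, and the relaxed iteration on frontal slices *)

Lemma eigenvalue_similar (K : fieldType) m (A B V : 'M[K]_m) (a : K) :
  V \in unitmx -> B *m V = V *m A -> eigenvalue B a = eigenvalue A a.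
Proof.
move=> uV BV; apply/eigenvalueP/eigenvalueP => -[v vA v0].
  exists (v *m V).
    by rewrite -mulmxA -BV mulmxA vA scalemxAl.
  by apply: contra_neq v0 => vV; rewrite -(mulmxK uV v) vV mul0mx.
exists (v *m invmx V).
  by rewrite -[LHS](mulmxK uV) -(mulmxA _ B) BV mulmxA mulmxKV // vA scalemxAl.
by apply: contra_neq v0 => vV; rewrite -(mulmxKV uV v) vV mul0mx.
Qed.

Section TensorSlices.
Variables (K : fieldType) (p : nat) (M : 'M[K]_p).
Hypothesis uM : M \in unitmx.

Lemma mprodA m n q r (A : tensor K m n p) (B : tensor K n q p)
    (D : tensor K q r p) : A *_[M] (B *_[M] D) = A *_[M] B *_[M] D.
Proof.
apply: (can_inj (mode3K uM)); apply/ffunP => k.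
by rewrite !mode3_mprod // mulmxA.
Qed.

Lemma mode3B m n (A B : tensor K m n p) k :
  mode3 (A - B) M k = mode3 A M k - mode3 B M k.
Proof.
apply/matrixP => i j; rewrite !ffunE !mxE -sumrB.
by apply: eq_bigr => l _; rewrite !ffunE !mxE mulrBl.
Qed.

Lemma mode3Z m n (c : K) (A : tensor K m n p) k :
  mode3 (c *: A) M k = c *: mode3 A M k.
Proof.
apply/matrixP => i j; rewrite !ffunE !mxE mulr_sumr.
by apply: eq_bigr => l _; rewrite !ffunE !mxE mulrA.
Qed.

Lemma mode3_tinv m (A : tensor K m m p) k : nonsingular M A ->
  mode3 (tinv M A) M k *m mode3 A M k = 1%:M.
Proof. by move=> /tinvP[_ ZA]; rewrite -mode3_mprod // ZA mode3_tid. Qed.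

Lemma mode3_relax m (A F G : tensor K m m p) (c : K) k :
  A = F - G -> nonsingular M F ->
  mode3 (tid m M - c *: (tinv M F *_[M] A)) M k =
    (1 - c)%:M + c *: mode3 (tinv M F *_[M] G) M k.
Proof.
move=> -> nF; rewrite mode3B mode3Z mode3_tid // !mode3_mprod // mode3B.
rewrite mulmxBr mode3_tinv // scalerBr opprB raddfB /= scale_scalar_mx mulr1.
by rewrite addrA addrAC.
Qed.

(** With [Z] the slice of the inverse of [F] and [A] read slicewise,
    [(1 - c Z A) Z = Z (1 - c A Z)], a similarity because [Z] is invertible. *)
Lemma eigenvalue_relaxC m (A F : tensor K m m p) (c : K) k :
  nonsingular M F ->
  eigenvalue (mode3 (tid m M - c *: (tinv M F *_[M] A)) M k) =1
  eigenvalue (mode3 (tid m M - c *: (A *_[M] tinv M F)) M k).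
Proof.
move=> nF a; have [uZ _] := mulmx1_unit (mode3_tinv k nF).
apply: (eigenvalue_similar _ uZ).
rewrite !mode3B !mode3Z mode3_tid // !mode3_mprod //.
by rewrite mulmxBr mulmxBl mulmx1 mul1mx -scalemxAr -scalemxAl !mulmxA.
Qed.

End TensorSlices.

(** * Spectral radii of complex matrices and tensors *)

Section SpectralRadius.
Variable R : realType.
Local Notation C := R[i].

Lemma Re_normc (z : C) : (complex.Re `|z|)%:C%C = `|z|.
Proof. by rewrite normc_def. Qed.

Lemma normC_real (c : R) : 0 <= c -> `|c%:C%C| = c%:C%C :> C.
Proof. by move=> c0; rewrite ger0_norm // ler0c. Qed.

Lemma spectral_radius_ge m (A : 'M[C]_m) (a : C) :
  eigenvalue A a -> complex.Re `|a| <= spectral_radius A.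
Proof.
move=> Aa; apply: ub_le_sup; last by exists a.
have [rs Ars] := closed_field_poly_normal (char_poly A).
(* Any upper bound suffices here; the sum of the moduli of all characteristic roots is one. *)
exists (\sum_(z <- rs) complex.Re `|z|) => _ [b Ab <-].
have Re0 (z : C) : 0 <= complex.Re `|z| by rewrite -ler0c Re_normc.
have brs : b \in rs.
  move: Ab; rewrite /= eigenvalue_root_char Ars rootZ ?root_prod_XsubC //.
  by rewrite lead_coef_eq0 monic_neq0 ?char_poly_monic.
rewrite (big_rem b) //= lerDl; apply: sumr_ge0 => z _; exact: Re0.
Qed.

Lemma spectral_radius_le m (A : 'M[C]_m) (r : R) : (0 < m)%N ->
  (forall a, eigenvalue A a -> `|a| <= r%:C%C) -> spectral_radius A <= r.
Proof.
move=> m0 Ar; have [b Ab] := eigenvalue_closed A m0.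
apply: ge_sup => [|_ [a /Ar + <-]]; first by exists (complex.Re `|b|), b.
by rewrite -lecR Re_normc.
Qed.

(** For [v T = a v], the triangle inequality gives [|a| |v| <= |v| T] entrywise, so the real
    subinvariance result applies to [|v|]. The case [a = 0] is separate because that result requires
    [r > 0]. *)
Lemma nonneg_eigenvalue m (T : 'M[C]_m) (a : C) :
  (forall i j, 0 <= T i j) -> eigenvalue T a ->
  exists2 s : R, complex.Re `|a| <= s & eigenvalue T s%:C%C.
Proof.
move=> T0 Ta; have [a_eq0|a0] := eqVneq a 0.
  by exists 0; [rewrite a_eq0 -lecR Re_normc normr0 | rewrite rmorph0 -a_eq0].
pose T' := map_mx (@complex.Re R) T.
have TE : T = map_mx (real_complex R) T'.
  apply/matrixP => i j; rewrite !mxE.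
  by have := T0 i j; case: (T i j) => ? ? /=; rewrite lecE /= => /andP[/eqP ->].
have [v vT v0] := eigenvalueP Ta.
pose x : 'rV[R]_m := \row_j complex.Re `|v 0 j|.
have [||j||j|s rs T's] := @subinvariant_eigenvalue R m T' (complex.Re `|a|) x.
- by move=> i j; rewrite -ler0c mxE; have := T0 i j; rewrite TE !mxE.
- by rewrite -ltcR Re_normc normr_gt0.
- by rewrite -ler0c mxE Re_normc.
- have [k vk] := rV0Pn _ v0; apply/rV0Pn; exists k.
  by rewrite mxE -(inj_eq (@complexI R)) Re_normc normr_eq0.
- move/rowP/(_ j): vT; rewrite !mxE => vTj.
  rewrite -lecR rmorphM rmorph_sum /= !Re_normc -normrM -vTj.
  apply: le_trans (ler_norm_sum _ _ _) _; rewrite le_eqVlt; apply/orP; left.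
  apply/eqP/eq_bigr => k _; rewrite mxE normrM rmorphM /= Re_normc.
  by rewrite (ger0_norm (T0 _ _)) [in LHS]TE mxE.
exists s; first exact: rs.
by rewrite TE (eigenvalue_map (real_complex R)); exact: T's.
Qed.

Lemma eigenvalue_affine m (T : 'M[C]_m) (c d b : C) : d != 0 ->
  eigenvalue (c%:M + d *: T) (c + d * b) = eigenvalue T b.
Proof.
move=> d0; apply/eigenvalueP/eigenvalueP => -[v vT v0]; exists v => //.
  move: vT; rewrite mulmxDr mul_mx_scalar -scalemxAr scalerDl -scalerA.
  by move/addrI/(scalerI d0).
by rewrite mulmxDr mul_mx_scalar -scalemxAr vT scalerDl scalerA.
Qed.

(** The upper bound is the triangle inequality. For the lower one, each eigenvalue of [T] is
    dominated in modulus by a real eigenvalue [s >= 0], and [(1 - a) + a s] is an eigenvalue of the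
    relaxed matrix equal to its own modulus. *)
Lemma spectral_radius_relax m (T : 'M[C]_m) (a : R) :
  (0 < m)%N -> (forall i j, 0 <= T i j) -> 0 < a < 1 ->
  spectral_radius ((1 - a)%:C%C%:M + a%:C%C *: T) =
    (1 - a) + a * spectral_radius T.
Proof.
move=> m0 T0 /andP[a0 a1].
have aC : a%:C%C != 0 :> C by rewrite fmorph_eq0 gt_eqF.
have : 0 <= 1 - a by lra.
move: (1 - a) => c c0.
apply/eqP; rewrite eq_le; apply/andP; split.
  apply: spectral_radius_le => // b.
  have -> : b = c%:C%C + a%:C%C * ((b - c%:C%C) / a%:C%C).
    by rewrite mulrC divfK // addrC subrK.
  move: (_ / _) => {}b; rewrite eigenvalue_affine // => /spectral_radius_ge Tb.
  apply: le_trans (ler_normD _ _) _; rewrite normrM !normC_real ?(ltW a0) //.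
  by rewrite -(Re_normc b) -rmorphM -rmorphD lecR lerD2l ler_pM2l.
rewrite -lerBrDl -ler_pdivlMl //; apply: spectral_radius_le => // b Tb.
have [s bs Ts] := nonneg_eigenvalue T0 Tb.
have s0 : 0 <= s by apply: le_trans bs; rewrite -ler0c Re_normc.
rewrite -Re_normc lecR (le_trans bs) // ler_pdivlMl // lerBrDl.
rewrite -(eigenvalue_affine T c%:C%C _ aC) in Ts.
have := spectral_radius_ge Ts; rewrite -rmorphM -rmorphD normC_real //.
by rewrite addr_ge0 // mulr_ge0 // ltW.
Qed.

(** An empty matrix has no eigenvalue, and the supremum of the empty set is 0. *)
Lemma spectral_radius_mxsize_gt0 m (A : 'M[C]_m) :
  0 < spectral_radius A -> (0 < m)%N.
Proof.
case: m A => // A; rewrite /spectral_radius; set E := (X in sup X).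
suff -> : E = set0 by rewrite sup0 ltxx.
apply/seteqP; split=> // r [a /eigenvalueP[v _ /negP[]]].
by apply/eqP/rowP => -[].
Qed.

Lemma eq_spectral_radius m (A B : 'M[C]_m) :
  eigenvalue A =1 eigenvalue B -> spectral_radius A = spectral_radius B.
Proof.
by move=> /funext AB; rewrite /spectral_radius AB.
Qed.

(** The slices need not compare one by one. A single slice of [S] exceeds the maximum over [T]; its
    relaxation then exceeds every relaxed slice of [T]. *)
Lemma tspectral_radius_relax_lt m p (M : 'M[C]_p) (T S X Y : tensor C m m p)
    (a : R) : 0 < a < 1 -> tnonneg M T -> tnonneg M S ->
  (forall k, mode3 X M k = (1 - a%:C%C)%:M + a%:C%C *: mode3 T M k) ->
  (forall k, mode3 Y M k = (1 - a%:C%C)%:M + a%:C%C *: mode3 S M k) ->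
  tspectral_radius M T < tspectral_radius M S ->
  tspectral_radius M X < tspectral_radius M Y.
Proof.
move=> a01 T0 S0 XE YE TS; have /andP[a0 a1] := a01.
have aC : 1 - a%:C%C = (1 - a)%:C%C by rewrite rmorphB rmorph1.
have Tge0 : 0 <= tspectral_radius M T by apply: bigmax_ge_id.
have [k Tk] : exists k, tspectral_radius M T < spectral_radius (mode3 S M k).
  apply: contrapT => noS; move: TS; rewrite ltNge => /negP[].
  apply: bigmax_le => // k _; rewrite leNgt; apply/negP => Tk.
  by apply: noS; exists k.
have m0 := spectral_radius_mxsize_gt0 (le_lt_trans Tge0 Tk).
have aTk : a * tspectral_radius M T < a * spectral_radius (mode3 S M k).
  by rewrite ltr_pM2l.
have aT0 : 0 <= a * tspectral_radius M T by rewrite mulr_ge0 // ltW.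
have Yk : 1 - a + a * tspectral_radius M T < tspectral_radius M Y.
  apply: lt_le_trans (_ : spectral_radius (mode3 Y M k) <= _); last first.
    exact: le_bigmax.
  by rewrite YE aC spectral_radius_relax // ltrD2l.
(* The maximum over slices starts from the default 0, which must also lie strictly below the
   bound. *)
have Y0 : 0 < tspectral_radius M Y.
  by apply: le_lt_trans Yk; rewrite addr_ge0 // subr_ge0 ltW.
move: (tspectral_radius M Y) Y0 Yk => y y0 Yk.
rewrite /tspectral_radius; apply: bigmax_lt => [|l _]; first exact: y0.
rewrite XE aC spectral_radius_relax //; apply: le_lt_trans Yk.
rewrite lerD2l (ler_pM2l a0).
exact: (le_bigmax 0 (fun k => spectral_radius (mode3 T M k)) l).
Qed.

Lemma splitting_relax_lt m p (M : 'M[C]_p) (A A' F F' G G' : tensor C m m p)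
    (a : R) : M \in unitmx -> 0 < a < 1 ->
  weak_regular_splitting M A F G -> weak_regular_splitting M A' F' G' ->
  tspectral_radius M (tinv M F *_[M] G) <
    tspectral_radius M (tinv M F' *_[M] G') ->
  tspectral_radius M (tid m M - a%:C%C *: (tinv M F *_[M] A)) <
    tspectral_radius M (tid m M - a%:C%C *: (tinv M F' *_[M] A')).
Proof.
move=> uM a01 [AE _ nF _ T0] [AE' _ nF' _ T0'].
apply: (tspectral_radius_relax_lt a01 T0 T0') => k.
  exact: mode3_relax.
exact: mode3_relax.
Qed.

(** Reduces the [X] iteration, where the inverse stands on the right, to the form covered by
    [splitting_relax_lt]. *)
Lemma tspectral_radius_relaxC m p (M : 'M[C]_p) (A F : tensor C m m p) (c : C) :
  M \in unitmx -> nonsingular M F ->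
  tspectral_radius M (tid m M - c *: (tinv M F *_[M] A)) =
    tspectral_radius M (tid m M - c *: (A *_[M] tinv M F)).
Proof.
move=> uM nF; rewrite /tspectral_radius; apply: eq_bigr => k _.
exact: eq_spectral_radius (eigenvalue_relaxC uM A c k nF).
Qed.

End SpectralRadius.

Theorem theorem3p20 (R : realType) (m n p : nat) (M : 'M[R[i]]_p)
    (A P1 : tensor R[i] m m p) (B P2 : tensor R[i] n n p)
    (C : tensor R[i] m n p)
    (F1 G1 Fp1 Gp1 : tensor R[i] m m p) (F2 G2 Fp2 Gp2 : tensor R[i] n n p) :
  M \in unitmx ->
  nonsingular M A -> nonsingular M B ->
  nonsingular M P1 -> nonsingular M P2 ->
  tnonneg M (tinv M A) -> tnonneg M (tinv M B) ->
  tnonneg M (tinv M (P1 *_[M] A)) -> tnonneg M (tinv M (B *_[M] P2)) ->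
  weak_regular_splitting M A F1 G1 ->
  weak_regular_splitting M (P1 *_[M] A) Fp1 Gp1 ->
  weak_regular_splitting M B F2 G2 ->
  weak_regular_splitting M (B *_[M] P2) Fp2 Gp2 ->
  tspectral_radius M (tinv M Fp1 *_[M] Gp1) <
    tspectral_radius M (tinv M F1 *_[M] G1) ->
  tspectral_radius M (tinv M Fp2 *_[M] Gp2) <
    tspectral_radius M (tinv M F2 *_[M] G2) ->
  forall alpha beta : R, 0 < alpha < 1 -> 0 < beta < 1 ->
  converges_faster M
    {| Yiter := tid m M - alpha%:C%C *: (tinv M Fp1 *_[M] P1 *_[M] A);
       Yconst := alpha%:C%C *: (tinv M Fp1 *_[M] P1 *_[M] C *_[M] P2);
       Xiter := tid n M - beta%:C%C *: (B *_[M] P2 *_[M] tinv M Fp2);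
       Xgain := beta%:C%C *: tinv M Fp2 |}
    {| Yiter := tid m M - alpha%:C%C *: (tinv M F1 *_[M] A);
       Yconst := alpha%:C%C *: (tinv M F1 *_[M] C);
       Xiter := tid n M - beta%:C%C *: (B *_[M] tinv M F2);
       Xgain := beta%:C%C *: tinv M F2 |}.
Proof.
move=> uM _ _ _ _ _ _ _ _ wA wPA wB wBP lt1 lt2 alpha beta a01 b01.
have nF2 : nonsingular M F2 by case: wB.
have nFp2 : nonsingular M Fp2 by case: wBP.
rewrite /converges_faster /Yiter /Xiter; split.
  (* Regrouping exposes [P1 *_[M] A], the tensor that is split; [B *_[M] P2] is already grouped by
     left associativity. *)
  rewrite -(mprodA uM (tinv M Fp1) P1 A).
  exact: splitting_relax_lt uM a01 wPA wA lt1.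
have ltE (x x' y y' : R) : x' = x -> y' = y -> x' < y' -> x < y.
  by move=> -> ->.
exact: ltE (tspectral_radius_relaxC _ _ uM nFp2)
  (tspectral_radius_relaxC _ _ uM nF2) (splitting_relax_lt uM b01 wBP wB lt2).
Qed.
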